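(* For every $\epsilon>0$ there exists a finite connected graph $G$ such that the following holds. Let $P$ be the transition matrix of simple random walk on $G$, with stationary distribution $\pi$, and let $X,Y,Z$ be independent continuous-time Markov chains with transition matrix $P$ and speeds $\lambda_X=1$, $\lambda_Y=0$, $\lambda_Z=1$ respectively, with $X_0,Y_0,Z_0$ independent with law $\pi$. Define $M^{\rm good}=\inf\{t\ge0:X_t=Y_t\}$ and $M^{\rm bad}=\inf\{t\ge0:X_t=Z_t\}\wedge\inf\{t\ge0:Y_t=Z_t\}$. Then \[\mathbb P\big(M^{\rm good}\le M^{\rm bad}\big)<\epsilon.\]
   Context: A continuous-time Markov chain with speed $\lambda$ and transition matrix $P$ jumps at rate $\lambda$ according to $P$ (generator $\lambda(P-I)$); speed $0$ means the chain stays at its initial state. *)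

(* Defs.v *)
From HB Require Import structures.
From mathcomp Require Import all_boot all_order all_algebra.
From mathcomp Require Import all_classical all_reals all_analysis.
Set Implicit Arguments. Unset Strict Implicit. Unset Printing Implicit Defensive.
Import Order.TTheory GRing.Theory Num.Theory.
Local Open Scope ring_scope.
Local Open Scope classical_set_scope.

Section Defs.
Variables (R : realType) (V : finType).

Definition simple_graph (e : rel V) : Prop :=
  symmetric e /\ irreflexive e.

Definition graph_connected (e : rel V) : Prop :=
  forall x y : V, connect e x y.

Definition deg (e : rel V) (x : V) : nat := #|[set y | e x y]|.

Definition srw (e : rel V) (x y : V) : R :=
  (e x y)%:R / (deg e x)%:R.

Definition stationary_distribution (P : V -> V -> R) (pi : V -> R) : Prop :=
  (forall x, 0 <= pi x) /\ \sum_x pi x = 1 /\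
  (forall y, \sum_x pi x * P x y = pi y).

Fixpoint mpow (A : V -> V -> R) (k : nat) : V -> V -> R :=
  match k with
  | 0 => fun x y => (x == y)%:R
  | k'.+1 => fun x y => \sum_z mpow A k' x z * A z y
  end.

Definition generator (lam : R) (P : V -> V -> R) (x y : V) : R :=
  lam * (P x y - (x == y)%:R).

Definition semigroup (lam : R) (P : V -> V -> R) (t : R) (x y : V) : R :=
  limn (fun n => \sum_(k < n) t ^+ k / (k`!)%:R
                   * mpow (generator lam P) k x y).

Definition fdd_weight (pi : V -> R) (lam : R) (P : V -> V -> R)
    (ts : nat -> R) (xs : nat -> V) (n : nat) : R :=
  pi (xs 0%N) * \prod_(i < n) semigroup lam P (ts i.+1 - ts i) (xs i) (xs i.+1).

(** Every path is right-continuous and piecewise constant (càdlàg on a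
    finite discrete state space): constant on some [t, t + delta). *)
Definition right_constant_paths (T : Type) (X : R -> T -> V) : Prop :=
  forall (w : T) (t : R), 0 <= t ->
    exists2 delta : R, 0 < delta &
      forall s, t <= s < t + delta -> X s w = X t w.

(** First meeting time of two processes, inf {t >= 0 : A_t = B_t}
    (= +oo if they never meet). *)
Definition meet_time (T : Type) (A B : R -> T -> V) (w : T) : \bar R :=
  ereal_inf [set (t%:E)%E | t in [set t : R | 0 <= t /\ A t w = B t w]].

(** X, Y, Z are independent continuous-time Markov chains with transition
    matrix P, speeds lX, lY, lZ and i.i.d. initial laws pi: joint
    finite-dimensional distributions factorize into the three chain laws,
    and all paths are right-continuous step functions. *)
Definition indep_ctmc3 (d : measure_display) (T : measurableType d)
    (Pr : probability T R) (P : V -> V -> R) (pi : V -> R) (lX lY lZ : R)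
    (X Y Z : R -> T -> V) : Prop :=
  (forall t (v : V), measurable [set w | X t w = v] /\
      measurable [set w | Y t w = v] /\ measurable [set w | Z t w = v]) /\
  right_constant_paths X /\ right_constant_paths Y /\ right_constant_paths Z /\
  (forall (n : nat) (ts : nat -> R) (xs ys zs : nat -> V),
     ts 0%N = 0 -> (forall i, (i < n)%N -> ts i <= ts i.+1) ->
     Pr [set w | forall i, (i <= n)%N ->
                 X (ts i) w = xs i /\ Y (ts i) w = ys i /\ Z (ts i) w = zs i]
     = (fdd_weight pi lX P ts xs n * fdd_weight pi lY P ts ys n
        * fdd_weight pi lZ P ts zs n)%:E).

End Defs.

(* Main.v *)
Require Import Defs.
From HB Require Import structures.
From mathcomp Require Import all_boot all_order all_algebra.
From mathcomp Require Import all_classical all_reals all_analysis.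
From mathcomp Require Import measurable_realfun ring lra.
Import Order.TTheory GRing.Theory Num.Theory.
Import numFieldNormedType.Exports.
Local Open Scope ring_scope.
Local Open Scope classical_set_scope.

(* On many cliques sharing a common neighbour (the hub), the moving walkers X
   and Z share their visits to the hub: the hub has stationary mass
   1/(M + 1), where M is the clique size, so X and Z meet within a time K that
   depends on M only. The static Y sits at the hub with probability 1/(M + 1)
   only; elsewhere X must hit it, and by stationarity X enters a given vertex
   y before time K with probability at most of order (1 + K) pi(y), so that X
   meets a non-hub Y before time K with probability of order (1 + K) times the
   sum of pi(y)^2, which is at most 1/N for N cliques. Choosing M, then K, then
   N large makes the probability of a good meeting coming first small. *)

(** * The semigroup of a finite generator *)

Section Semigroup.
Variables (R : realType) (V : finType).
Implicit Types (P Q : V -> V -> R) (pi : V -> R).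

Definition stochastic P : Prop :=
  (forall x y, 0 <= P x y) /\ (forall x, \sum_y P x y = 1).

Lemma sum_indicator (x : V) : \sum_y ((x == y)%:R : R) = 1.
Proof.
rewrite (bigD1 x)//= eqxx big1 ?addr0// => y yx.
by rewrite eq_sym (negbTE yx).
Qed.

Lemma generator_row_sum lam P x : stochastic P -> \sum_y generator lam P x y = 0.
Proof.
move=> [_ P1]; rewrite -mulr_sumr sumrB P1 sum_indicator.
by rewrite subrr mulr0.
Qed.

(** The rows of [P] and of the identity both have mass 1. This is the constant 2 in every
    exponential bound below. *)
Lemma generator_row_norm lam P x :
  stochastic P -> \sum_y `|generator lam P x y| <= 2 * `|lam|.
Proof.
move=> [P0 P1]; under eq_bigr do rewrite normrM.
rewrite -mulr_sumr mulrC ler_wpM2r//.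
apply: (@le_trans _ _ (\sum_y (P x y + (x == y)%:R))).
  apply: ler_sum => y _; apply: (le_trans (ler_normB _ _)).
  by rewrite ger0_norm// ger0_norm.
by rewrite big_split/= P1 sum_indicator.
Qed.

Lemma mpow_row_norm Q k x (C : R) : (forall x, \sum_y `|Q x y| <= C) ->
  \sum_y `|mpow Q k x y| <= C ^+ k.
Proof.
move=> QC; have C0 : 0 <= C by apply: le_trans (QC x); exact: sumr_ge0.
elim: k => [|k IH] /=.
  by under eq_bigr do rewrite normr_nat; rewrite sum_indicator expr0.
apply: (@le_trans _ _ (\sum_y \sum_z `|mpow Q k x z| * `|Q z y|)).
  apply: ler_sum => y _; apply: (le_trans (ler_norm_sum _ _ _)).
  by apply: ler_sum => z _; rewrite normrM.
rewrite exchange_big/=.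
apply: (@le_trans _ _ (\sum_z `|mpow Q k x z| * C)).
  by apply: ler_sum => z _; rewrite -mulr_sumr ler_wpM2l.
by rewrite -mulr_suml exprSr ler_wpM2r.
Qed.

Lemma mpow_norm Q k x y (C : R) : (forall x, \sum_y `|Q x y| <= C) ->
  `|mpow Q k x y| <= C ^+ k.
Proof.
move=> /(mpow_row_norm Q k x); apply: le_trans.
by rewrite (bigD1 y)//= lerDl sumr_ge0.
Qed.

Lemma mpow_row_sum Q k x : (forall x, \sum_y Q x y = 0) ->
  \sum_y mpow Q k x y = (k == 0)%:R.
Proof.
move=> Q0; case: k => [|k] /=; first exact: sum_indicator.
rewrite exchange_big big1//= => z _.
by rewrite -mulr_sumr Q0 mulr0.
Qed.

Lemma mpow_left_null Q pi k y : (forall y, \sum_x pi x * Q x y = 0) ->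
  \sum_x pi x * mpow Q k x y = (k == 0)%:R * pi y.
Proof.
move=> piQ; case: k => [|k] /=.
  rewrite (bigD1 y)//= eqxx mulr1 mul1r big1 ?addr0// => x xy.
  by rewrite (negbTE xy) mulr0.
rewrite mul0r; elim: k y => [|k IH] y /=;
  under eq_bigr do rewrite mulr_sumr; rewrite exchange_big /=.
  rewrite -[RHS](piQ y); apply: eq_bigr => z _.
  rewrite (bigD1 z)//= eqxx mul1r big1 ?addr0// => x xz.
  by rewrite (negbTE xz) mul0r mulr0.
rewrite big1// => z _; under eq_bigr do rewrite mulrA.
by rewrite -mulr_suml IH mul0r.
Qed.

(** [limn] carries information only once convergence is known. Termwise, the series is dominated by
    that of the exponential at [|t| * (2 * |lam|)]. *)
Lemma semigroup_cvg lam P t x y : stochastic P ->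
  (\sum_(k < n) t ^+ k / (k`!)%:R * mpow (generator lam P) k x y)
    @[n --> \oo] --> semigroup lam P t x y.
Proof.
move=> sP; set u := fun k => t ^+ k / (k`!)%:R * mpow (generator lam P) k x y.
rewrite /semigroup.
have -> : (fun n => \sum_(k < n) u k) = series u.
  by apply/funext => n; rewrite /series/= big_mkord.
apply: normed_cvg.
apply: (@series_le_cvg _ _ (exp_coeff (`|t| * (2 * `|lam|)))) => [n|n|n|].
- exact: normr_ge0.
- by apply: exp_coeff_ge0; rewrite !mulr_ge0.
- rewrite /exp_coeff/= /u normrM normrM normfV normr_nat normrX exprMn mulrAC.
  rewrite ler_wpM2r// ler_wpM2l ?exprn_ge0//.
  by apply: mpow_norm => z; exact: generator_row_norm.
- exact: is_cvg_series_exp_coeff.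
Qed.

Lemma semigroup_unique lam P t x y l : stochastic P ->
  (\sum_(k < n) t ^+ k / (k`!)%:R * mpow (generator lam P) k x y)
    @[n --> \oo] --> l -> semigroup lam P t x y = l.
Proof.
by move=> sP; apply: cvg_unique; [exact: Rhausdorff|exact: semigroup_cvg].
Qed.

(** Carries row sums and stationarity from partial sums to the semigroup. The index [n.+1] skips the
    empty partial sum, which lacks the term [k = 0]. *)
Lemma cvg_linear (I : finType) (u : I -> nat -> R) (a l : I -> R) (l' : R) :
  (forall i, u i n @[n --> \oo] --> l i) ->
  (forall n, \sum_i a i * u i n.+1 = l') -> \sum_i a i * l i = l'.
Proof.
move=> ul uE.
have : \sum_i a i * u i n @[n --> \oo] --> \sum_i a i * l i.
  apply: cvg_big => [|i _]; first exact: add_continuous.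
  by apply: cvgM; [exact: cvg_cst|exact: ul].
move=> /cvg_unique; apply => //.
rewrite /= -cvg_shiftS /=.
by under eq_fun do rewrite uE; exact: cvg_cst.
Qed.

Lemma sum_indicator_ord (F : nat -> R) n :
  \sum_(k < n.+1) F k * ((k : nat) == 0)%:R = F 0.
Proof.
rewrite big_ord_recl/= mulr1 big1 ?addr0// => i _.
by rewrite mulr0.
Qed.

Lemma semigroup_row_sum lam P t x : stochastic P ->
  \sum_y semigroup lam P t x y = 1.
Proof.
move=> sP; under eq_bigr do rewrite -[semigroup _ _ _ _ _]mul1r.
apply: cvg_linear => [y|n]; first exact: semigroup_cvg.
under eq_bigr do rewrite mul1r.
rewrite exchange_big/=; under eq_bigr => k _.
  rewrite -mulr_sumr mpow_row_sum; last by move=> z; exact: generator_row_sum.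
  over.
by rewrite (sum_indicator_ord (fun k => t ^+ k / (k`!)%:R)) expr0 fact0 divr1.
Qed.

Lemma semigroup_stationary lam P pi t y : stochastic P ->
  stationary_distribution P pi ->
  \sum_x pi x * semigroup lam P t x y = pi y.
Proof.
move=> sP [_ [_ piP]].
apply: cvg_linear => [x|n]; first exact: semigroup_cvg.
have piQ z : \sum_x pi x * generator lam P x z = 0.
  under eq_bigr do rewrite mulrCA mulrBr.
  rewrite -mulr_sumr sumrB piP (bigD1 z)//= eqxx mulr1 big1 ?addr0.
    by rewrite subrr mulr0.
  by move=> x xz; rewrite (negbTE xz) mulr0.
under eq_bigr do rewrite mulr_sumr; rewrite exchange_big/=.
under eq_bigr => k _.
  under eq_bigr do rewrite mulrCA.
  rewrite -mulr_sumr (mpow_left_null _ _ _ _ piQ) mulrA mulrAC; over.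
rewrite (sum_indicator_ord (fun k => t ^+ k / (k`!)%:R * pi y)).
by rewrite expr0 fact0 divr1 mul1r.
Qed.

Lemma semigroup_id lam P t x y : stochastic P -> lam = 0 \/ t = 0 ->
  semigroup lam P t x y = (x == y)%:R.
Proof.
move=> sP lt0; apply: semigroup_unique => //; rewrite -cvg_shiftS /=.
apply: cvg_near_cst; apply: nearW => n.
rewrite big_ord_recl/= expr0 fact0 divr1 mul1r big1 ?addr0// => i _.
case: lt0 => [->|->]; last by rewrite expr0n /= !mul0r.
by rewrite big1 ?mulr0// => z _; rewrite /generator mul0r mulr0.
Qed.

(** The term [k = 0] of the series is 1, and the others are at most those of [expR (2 * t)] in
    absolute value. The loss is linear in small [t], which suits a fine time grid. *)
Lemma semigroup_diag_lower P t y : stochastic P -> 0 <= t ->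
  1 - semigroup 1 P t y y <= expR (2 * t) - 1.
Proof.
move=> sP t0; suff : 2 - expR (2 * t) <= semigroup 1 P t y y by lra.
apply: limr_ge; first exact: (cvgP _ (semigroup_cvg 1 P t y y sP)).
exists 1 => // -[//|n] _ /=; rewrite big_ord_recl/= eqxx expr0 fact0 divr1 mul1r.
have : series (exp_coeff (2 * t)) n.+1 <= expR (2 * t).
  apply: nondecreasing_cvgn_le; last exact: is_cvg_series_exp_coeff.
  apply/nondecreasing_seqP => m; rewrite /series/= big_nat_recr//= lerDl.
  by apply: exp_coeff_ge0; rewrite mulr_ge0.
have e0 : exp_coeff (2 * t) 0 = 1 by rewrite /exp_coeff/= expr0 fact0 divr1.
rewrite /series/= big_mkord big_ord_recl/= e0.
set S := \sum_(i < n) _; set S' := \sum_(i < n) _ => SE.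
suff : - S <= S' by lra.
rewrite /S /S' -sumrN; apply: ler_sum => i _.
rewrite lerNl; apply: le_trans (ler_norm _) _.
rewrite normrN normrM normrM normfV normr_nat normrX ger0_norm//.
rewrite /exp_coeff/= exprMn -[leRHS]mulrA [leRHS]mulrC.
rewrite ler_wpM2l ?divr_ge0 ?exprn_ge0//.
apply: (mpow_norm _ i.+1) => z.
by apply: le_trans (generator_row_norm _ _ _ sP) _; rewrite normr1 mulr1.
Qed.

(* The column of [P] at [h] being [(1 - delta) / M], the vector [delta - a]
   with [a = 1 / (M + 1)] is an eigenvector of the generator. *)
Lemma semigroup_column P h x (M t : R) : stochastic P -> 0 < M ->
  (forall z, P z h = (z != h)%:R / M) ->
  semigroup 1 P t x h =
    (M + 1)^-1 + ((x == h)%:R - (M + 1)^-1) * expR (- ((1 + M^-1) * t)).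
Proof.
move=> sP M0 Ph; set a := (M + 1)^-1; set s := 1 + M^-1.
have QE z : generator 1 P z h = M^-1 - s * (z == h)%:R.
  rewrite /generator mul1r Ph /s; case: eqP => _ /=; ring.
(* Split the indicator of [h] as the constant [a] plus the eigenvector: the generator kills the
   first and multiplies the second by [- s]. *)
have powE k : mpow (generator 1 P) k x h =
    a * (k == 0)%:R + ((x == h)%:R - a) * (- s) ^+ k.
  elim: k => [|k IH]; first by rewrite /= expr0; ring.
  rewrite /= ; under eq_bigr do rewrite QE mulrBr.
  rewrite sumrB -mulr_suml mpow_row_sum; last first.
    by move=> z; exact: generator_row_sum.
  rewrite (bigD1 h)//= eqxx big1 ?addr0; last first.
    by move=> z zh; rewrite (negbTE zh) !mulr0.
  rewrite IH mulr1 exprS; have : a * s = M^-1 by rewrite /a /s; field; lra.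
  by case: k {IH} => [|k] /= as_; rewrite ?expr0 -as_; ring.
apply: semigroup_unique => //; rewrite -cvg_shiftS /=.
rewrite (_ : (fun n => _) = (fun n => a +
    ((x == h)%:R - a) * series (exp_coeff (- (s * t))) n.+1)).
  apply: cvgD; first exact: cvg_cst.
  apply: cvgM; first exact: cvg_cst.
  rewrite (cvg_shiftS (series (exp_coeff (- (s * t))))).
  exact: is_cvg_series_exp_coeff.
apply/funext => n; under eq_bigr do rewrite powE mulrDr mulrA.
rewrite big_split/= (sum_indicator_ord (fun k => t ^+ k / (k`!)%:R * a)).
rewrite expr0 fact0 divr1 mul1r /series/= big_mkord mulr_sumr; congr (_ + _).
apply: eq_bigr => i _; rewrite /exp_coeff/= -mulNr exprMn; ring.
Qed.

End Semigroup.

(** * The windmill graph *)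

Section Graph.
Variable R : realType.

Lemma deg_sum (V : finType) (e : rel V) x : deg e x = (\sum_y e x y)%N.
Proof.
rewrite /deg -sum1_card big_mkcond/=; apply: eq_bigr => y _.
have -> : (y \in [set y | e x y]) = e x y.
  by apply/idP/idP; rewrite inE.
by case: (e x y).
Qed.

Lemma srw_stochastic (V : finType) (e : rel V) :
  (forall x, 0 < deg e x)%N -> stochastic R V (srw R e).
Proof.
move=> deg0; split=> [x y|x]; first by rewrite divr_ge0.
rewrite -mulr_suml -natr_sum -deg_sum divff//.
by rewrite pnatr_eq0 -lt0n.
Qed.

Lemma big_option (A : Type) (idx : A) (op : Monoid.com_law idx) (T : finType)
    (F : option T -> A) :
  \big[op/idx]_x F x = op (F None) (\big[op/idx]_t F (Some t)).
Proof.
rewrite (bigD1 None)//=; congr (op _ _).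
rewrite (reindex_omap (Some : T -> _) id)/=; last by case.
by apply: eq_bigl => t; rewrite eqxx.
Qed.

Variables N m : nat.
Let clique_vertex : finType := ('I_N.+1 * 'I_m.+1)%type.
Let V : finType := option clique_vertex.

(* [N + 1] disjoint cliques of size [m + 1], all joined to the hub [None]. *)
Definition windmill : rel V := fun x y =>
  match x, y with
  | None, None => false
  | Some u, Some v => (u.1 == v.1) && (u.2 != v.2)
  | _, _ => true
  end.

Lemma windmill_simple : simple_graph windmill.
Proof.
split=> [[[i a]|] [[j b]|]|[[i a]|]] //=; last by rewrite !eqxx.
by rewrite eq_sym [a == b]eq_sym.
Qed.

Lemma windmill_connected : graph_connected windmill.
Proof.
move=> x y; apply: (@connect_trans _ _ None).
  by case: x => [u|]; [exact: connect1|exact: connect0].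
by case: y => [u|]; [exact: connect1|exact: connect0].
Qed.

Lemma sum_neq n (a : 'I_n.+1) : (\sum_(b < n.+1) (a != b))%N = n.
Proof.
transitivity #|predC1 a|; last by rewrite cardC1 card_ord.
rewrite -sum1_card [RHS]big_mkcond/=; apply: eq_bigr => b _.
by rewrite inE eq_sym; case: (b == a).
Qed.

Lemma deg_hub : deg windmill None = (N.+1 * m.+1)%N.
Proof.
rewrite deg_sum big_option /= add0n sum1_card.
by rewrite card_prod !card_ord.
Qed.

Lemma big_clique (A : Type) (idx : A) (op : Monoid.com_law idx)
    (F : clique_vertex -> A) i : (forall v, v.1 != i -> F v = idx) ->
  \big[op/idx]_v F v = \big[op/idx]_a F (i, a).
Proof.
move=> F0; transitivity (\big[op/idx]_j \big[op/idx]_a F (j, a)).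
  by rewrite pair_bigA/=; apply: eq_bigr => -[].
rewrite (bigD1 i)//= [X in op _ X]big1 ?Monoid.mulm1// => j ji.
by apply: big1 => a _; exact: F0.
Qed.

Lemma deg_clique u : deg windmill (Some u) = m.+1.
Proof.
rewrite deg_sum big_option /= -[in RHS](sum_neq _ u.2).
congr (_ + _)%N; rewrite (big_clique _ _ _ _ u.1)/=.
  by apply: eq_bigr => a _; rewrite eqxx.
by move=> v; rewrite eq_sym => /negbTE ->.
Qed.

Lemma windmill_stochastic : stochastic R V (srw R windmill).
Proof.
by apply: srw_stochastic => -[u|]; rewrite ?deg_clique ?deg_hub.
Qed.

Lemma srw_to_hub x : srw R windmill x None = (x != None)%:R / m.+1%:R.
Proof.
by case: x => [u|]; rewrite /srw ?deg_clique//= !mul0r.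
Qed.

Variable pi : V -> R.
Hypothesis st : stationary_distribution (srw R windmill) pi.

(** Every other vertex steps to the hub with probability [1 / m.+1], so the balance equation at the
    hub alone is a linear equation for [pi None]. *)
Lemma stationary_hub : pi None = (m.+1%:R + 1)^-1.
Proof.
have [_ [pi1 piP]] := st.
have := piP None; under eq_bigr do rewrite srw_to_hub mulrA.
rewrite -mulr_suml big_option/= mulr0 add0r.
under eq_bigr do rewrite mulr1.
have -> : \sum_t pi (Some t) = 1 - pi None.
  by rewrite -pi1 big_option addrC addKr.
have M0 : (m.+1%:R : R) > 0 by [].
move: M0; set M : R := m.+1%:R => M0.
move/(congr1 ( *%R^~ M)); rewrite mulfVK ?gt_eqF// => E.
apply: (@mulfI _ (M + 1)); first by rewrite gt_eqF// addr_gt0.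
rewrite divff; last by rewrite gt_eqF// addr_gt0.
by rewrite mulrDl mul1r mulrC -E subrK.
Qed.

(** The mass of a vertex is at most the mass [S] of its clique, and [S] is determined by the flow
    between the clique and the hub. *)
Lemma stationary_clique u : pi (Some u) <= N.+1%:R^-1.
Proof.
have [pi0 [pi1 piP]] := st; case: u => i a0.
pose S := \sum_a pi (Some (i, a)).
have M0 : (m.+1%:R : R) > 0 by [].
have N0 : (N.+1%:R : R) > 0 by [].
(* Balance at [(i, a)]: mass arrives from the hub and from the other vertices of the same clique. *)
have piE a : pi (Some (i, a)) =
    pi None / (N.+1%:R * m.+1%:R) + (S - pi (Some (i, a))) / m.+1%:R.
  rewrite -{1}(piP (Some (i, a))) big_option/=.
  rewrite {1}/srw deg_hub /= mul1r natrM; congr (_ + _).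
  rewrite (big_clique _ _ _ _ i)/=.
    rewrite /S mulrBl mulr_suml [in RHS](bigD1 a)//= [in RHS]addrC addrK.
    rewrite (bigD1 a)//= {1}/srw /= !eqxx/= mul0r mulr0 add0r.
    by apply: eq_bigr => b ba; rewrite /srw deg_clique/= eqxx ba mul1r.
  by move=> v /negbTE vi; rewrite /srw /= vi mul0r mulr0.
have : S = m.+1%:R * pi None / N.+1%:R.
  (* Summing the balance equations over the clique leaves inflow from the hub equal to outflow
     [S / m.+1]. *)
  have : S = pi None / N.+1%:R + S - S / m.+1%:R.
    rewrite {1}/S; under eq_bigr do rewrite piE.
    rewrite big_split/= -[X in _ + X]mulr_suml sumrB -/S !sumr_const card_ord.
    rewrite -(mulr_natr (_ / _)) -(mulr_natr S).
    move: (m.+1%:R) (N.+1%:R) M0 N0 => M K M0 K0.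
    by field; rewrite !gt_eqF.
  move=> E; have {}E : S / m.+1%:R = pi None / N.+1%:R.
    by move: E; move: (S / _) (pi None / _) => x y; lra.
  by rewrite -mulrA -E mulrCA divff ?mulr1// gt_eqF.
rewrite stationary_hub => SE.
apply: (@le_trans _ _ S).
  by rewrite /S (bigD1 a0)//= lerDl sumr_ge0.
rewrite SE ler_piMl ?invr_ge0// ler_pdivrMr ?addr_gt0//.
by rewrite mul1r lerDl.
Qed.

End Graph.

(** * Probability estimates *)

Section Probability.
Context {d : measure_display} {T : measurableType d} {R : realType}.
Variable Pr : probability T R.

Lemma fsbig_finType (A : Type) (idx : A) (op : Monoid.com_law idx) (I : finType)
    (F : I -> A) : \big[op/idx]_(i \in [set: I]) F i = \big[op/idx]_i F i.
Proof.
have -> : [set: I] = [set` index_enum I].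
  by apply/seteqP; split => // i _ /=; rewrite mem_index_enum.
by rewrite -fsbig_seq ?index_enum_uniq.
Qed.

Lemma total_probability (I : finType) (f : T -> I) (A : set T) :
  measurable A -> (forall i, measurable [set w | f w = i]) ->
  Pr A = (\sum_i Pr (A `&` [set w | f w = i]))%E.
Proof.
move=> mA mf; rewrite -fsbig_finType -measure_fin_bigcup//.
- congr (Pr _); apply/seteqP; split=> [w Aw|w [i _ []]//].
  by exists (f w).
- exact: finite_finset.
- by move=> i j _ _ [w [[_ <-] [_ <-]]].
- by move=> i _; exact: measurableI.
Qed.

Lemma total_probability_EFin (I : finType) (f : T -> I) (A : set T)
    (a : I -> R) :
  measurable A -> (forall i, measurable [set w | f w = i]) ->
  (forall i, Pr (A `&` [set w | f w = i]) = (a i)%:E) ->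
  Pr A = (\sum_i a i)%:E.
Proof.
move=> mA mf PrE; rewrite (total_probability I f)//.
by under eq_bigr do rewrite PrE; rewrite sumEFin.
Qed.

(** A point of the union lies in [A 0] or, at its first index, enters some [A k.+1] from outside
    [A k]. *)
Lemma entrance_bound (A : nat -> set T) n (a b : R) :
  (forall k, measurable (A k)) -> (Pr (A 0%N) <= a%:E)%E ->
  (forall k, (k < n)%N -> (Pr (A k.+1 `\` A k) <= b%:E)%E) ->
  (Pr (\bigcup_(k in [set k | (k <= n)%N]) A k) <= (a + n%:R * b)%:E)%E.
Proof.
move=> mA Aa; elim: n => [|n IH] Ab.
  rewrite mul0r addr0 (_ : \bigcup_(k in _) _ = A 0%N)//.
  apply/seteqP; split=> [w [k /=]|w Aw]; last by exists 0%N.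
  by rewrite leqn0 => /eqP ->.
have mU : measurable (\bigcup_(k in [set k | (k <= n)%N]) A k).
  exact: bigcup_measurable.
apply: (@le_trans _ _ (Pr (\bigcup_(k in [set k | (k <= n)%N]) A k) +
                       Pr (A n.+1 `\` A n))%E).
  apply: (@le_trans _ _ (Pr ((\bigcup_(k in [set k | (k <= n)%N]) A k) `|`
                             (A n.+1 `\` A n)))); last first.
    by apply: measureU2 => //; exact: measurableD.
  apply: le_measure; rewrite ?inE.
  - exact: bigcup_measurable.
  - by apply: measurableU => //; exact: measurableD.
  - move=> w [k /=]; rewrite leq_eqVlt => /orP[/eqP ->|kn] Ak; last first.
      by left; exists k.
    by have [An|An] := pselect (A n w); [left; exists n => /=|right].
have -> : (a + n.+1%:R * b)%:E = ((a + n%:R * b)%:E + b%:E)%E.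
  by rewrite -EFinD -natr1 mulrDl mul1r addrA.
apply: leeD; last exact: Ab.
by apply: IH => k kn; apply: Ab; exact: ltnW.
Qed.

Lemma prob_setD (A B : set T) (a b : R) : measurable A -> measurable B ->
  Pr A = a%:E -> Pr (A `&` B) = b%:E -> Pr (A `\` B) = (a - b)%:E.
Proof.
move=> mA mB PA PAB; transitivity (Pr A - Pr (A `&` B))%E; last by rewrite PA PAB EFinB.
apply: measureD => //; change (Pr A < +oo)%E.
by rewrite PA ltry.
Qed.

End Probability.

(** * Meeting times seen through dyadic times *)

Section Dyadic.
Variable R : realType.

Lemma dyadic_between (t u : R) : 0 <= t -> t < u ->
  exists n k : nat, t <= k%:R / 2 ^+ n < u.
Proof.
move=> t0 tu; pose e := u - t; have e0 : 0 < e by rewrite subr_gt0.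
(* This makes the mesh [1 / 2 ^+ n.+1] smaller than [u - t], so the first multiple of the mesh
   beyond [t] is still below [u]. *)
pose n := Num.truncn e^-1.
have n2 : e^-1 < 2 ^+ n.+1 :> R.
  apply: (lt_le_trans (truncnS_gt e^-1)); rewrite -/n -natrX ler_nat.
  by rewrite ltnW// ltn_expl.
have p0 : 0 < 2 ^+ n.+1 :> R by exact: exprn_gt0.
exists n.+1, (Num.truncn (t * 2 ^+ n.+1)).+1.
have /andP[kl ku] : (Num.truncn (t * 2 ^+ n.+1))%:R <= t * 2 ^+ n.+1 <
    (Num.truncn (t * 2 ^+ n.+1)).+1%:R.
  by apply: truncn_itv; rewrite mulr_ge0// ltW.
rewrite ler_pdivlMr// ltW//= ltr_pdivrMr//.
have : 1 < e * 2 ^+ n.+1 by rewrite -ltr_pdivrMl// mulr1.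
rewrite -natr1 /e; set p := 2 ^+ n.+1 in p0 kl ku *; lra.
Qed.

Section Paths.
Variables (V : finType) (T : Type) (A B : R -> T -> V).
Hypotheses (cA : right_constant_paths A) (cB : right_constant_paths B).

(** Both paths keep their values on a short interval to the right of [t], and this interval contains
    a dyadic time below [r]. *)
Lemma dyadic_meeting w (t r : R) : 0 <= t -> t < r -> A t w = B t w ->
  exists n k : nat, k%:R / 2 ^+ n < r /\
    A (k%:R / 2 ^+ n) w = B (k%:R / 2 ^+ n) w.
Proof.
move=> t0 tr AB.
have [dA dA0 hA] := cA w t t0; have [dB dB0 hB] := cB w t t0.
have [|n [k /andP[tk ku]]] :=
    @dyadic_between t (Num.min r (Num.min (t + dA) (t + dB))) t0.
  by rewrite !lt_min tr !ltrDl dA0 dB0.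
move: ku; rewrite !lt_min => /and3P[kr kA kB].
by exists n, k; split=> //; rewrite hA ?hB ?tk.
Qed.

(** Turns an uncountable infimum into a countable union, both for measurability and for the
    estimates on time grids. *)
Lemma meet_time_ltP w (r : R) :
  (meet_time A B w < r%:E)%E <->
  exists n k : nat, k%:R / 2 ^+ n < r /\
    A (k%:R / 2 ^+ n) w = B (k%:R / 2 ^+ n) w.
Proof.
split=> [/ereal_inf_lt[_ [t [t0 AB] <-]]|[n [k [kr AB]]]].
  by rewrite lte_fin => tr; exact: (dyadic_meeting w t r).
apply: (@le_lt_trans _ _ (k%:R / 2 ^+ n)%:E); last by rewrite lte_fin.
apply: ereal_inf_lbound; by exists (k%:R / 2 ^+ n).
Qed.

End Paths.

Lemma measurable_equal_values d (T : measurableType d) (V : finType)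
    (f g : T -> V) :
  (forall v, measurable [set w | f w = v]) ->
  (forall v, measurable [set w | g w = v]) -> measurable [set w | f w = g w].
Proof.
move=> mf mg.
rewrite (_ : [set w | f w = g w] =
    \bigcup_(v in [set: V]) ([set w | f w = v] `&` [set w | g w = v])).
  apply: fin_bigcup_measurable; first exact: finite_finset.
  by move=> v _; exact: measurableI.
apply/seteqP; split=> [w fg|w [v _ [/= -> ->]]//].
by exists (g w).
Qed.

Lemma measurable_meet_time d (T : measurableType d) (V : finType)
    (A B : R -> T -> V) :
  right_constant_paths A -> right_constant_paths B ->
  (forall t v, measurable [set w | A t w = v]) ->
  (forall t v, measurable [set w | B t w = v]) ->
  measurable_fun [set: T] (meet_time A B).
Proof.
move=> cA cB mA mB mT; apply: (measurability _ (ErealGenInftyO.measurableE R)) => //.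
move=> _ [_ [r ->] <-]; rewrite setTI.
rewrite (_ : _ @^-1` _ = \bigcup_n \bigcup_(k in [set k | k%:R / 2 ^+ n < r])
    [set w | A (k%:R / 2 ^+ n) w = B (k%:R / 2 ^+ n) w]).
  apply: bigcup_measurable => n _; apply: bigcup_measurable => k _.
  exact: measurable_equal_values.
apply/seteqP; split=> w /=; rewrite in_itv/=.
  by move=> /(meet_time_ltP _ _ _ _ cA cB)[n [k [kr AB]]]; exists n => //; exists k.
move=> [n _ [k /= kr AB]].
by apply/(meet_time_ltP _ _ _ _ cA cB); exists n, k.
Qed.

End Dyadic.

(** Multiply [1 - u <= expR (- u)] by [expR u]. *)
Lemma expRB1_le (R : realType) (u : R) : expR u - 1 <= u * expR u.
Proof.
have := expR_ge1Dx (- u).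
rewrite -(ler_pM2l (expR_gt0 u)) expRxMexpNx_1 mulrDr mulr1 mulrN mulrC; lra.
Qed.

(** * Meeting estimates for the three chains *)

Section Chains.
Context {d : measure_display} {T : measurableType d} {R : realType}.
Context {V : finType}.
Variables (Pr : probability T R) (P : V -> V -> R) (pi : V -> R).
Variables X Y Z : R -> T -> V.
Hypotheses (sP : stochastic R V P) (st : stationary_distribution P pi).
Hypothesis chains : indep_ctmc3 Pr P pi 1 0 1 X Y Z.

Let pi0 x : 0 <= pi x. Proof. by have [] := st. Qed.
Let pi1 : \sum_x pi x = 1. Proof. by have [_ []] := st. Qed.

Lemma measurable_X t v : measurable [set w | X t w = v].
Proof. by have [/(_ t v)[]] := chains. Qed.

Lemma measurable_Y t v : measurable [set w | Y t w = v].
Proof. by have [/(_ t v)[_ []]] := chains. Qed.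

Lemma measurable_Z t v : measurable [set w | Z t w = v].
Proof. by have [/(_ t v)[_ []]] := chains. Qed.

Lemma prob_two_times t u x x' y y' : 0 <= t -> t <= u ->
  Pr ([set w | X t w = x] `&` [set w | X u w = x'] `&`
      [set w | Y t w = y] `&` [set w | Y u w = y']) =
  (pi x * semigroup 1 P (u - t) x x' * (pi y * (y == y')%:R))%:E.
Proof.
move=> t0 tu; set A := (X in Pr X).
have mX := measurable_X; have mY := measurable_Y; have mZ := measurable_Z.
have mA : measurable A by do !apply: measurableI.
pose w1 := semigroup 1 P t; pose w2 := semigroup 1 P (u - t).
have PA x0 y0 z0 z1 z2 : Pr (A `&` [set w | X 0 w = x0] `&`
    [set w | Y 0 w = y0] `&` [set w | Z 0 w = z0] `&` [set w | Z t w = z1] `&`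
    [set w | Z u w = z2]) =
    (pi x0 * w1 x0 x * w2 x x' * (pi y0 * (y0 == y)%:R * (y == y')%:R) *
     (pi z0 * w1 z0 z1 * w2 z1 z2))%:E.
  have [_ [_ [_ [_ fdd]]]] := chains.
  have := fdd 2%N (nth 0 [:: 0; t; u]) (nth x [:: x0; x; x'])
    (nth x [:: y0; y; y']) (nth x [:: z0; z1; z2]) erefl.
  rewrite /fdd_weight !big_ord_recr !big_ord0 /= !subr0 !mul1r.
  rewrite !(semigroup_id _ _ 0 P) ?mulrA; [|by []|by left|by []|by left].
  move=> <-; last by case=> [|[|]].
  congr (Pr _); apply/seteqP; split=> w.
    by move=> [[[[[[[[Xt Xu] Yt] Yu] X0] Y0] Z0] Zt] Zu] [|[|[|]]].
  move=> W; have [X0 [Y0 Z0]] := W 0%N isT; have [Xt [Yt Zt]] := W 1%N isT.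
  by have [Xu [Yu Zu]] := W 2%N isT.
(* [Z] is removed from its latest time backwards, so that each sum is a row sum of a semigroup and
   finally the mass of [pi]. *)
have {}PA x0 y0 z0 z1 : Pr (A `&` [set w | X 0 w = x0] `&`
    [set w | Y 0 w = y0] `&` [set w | Z 0 w = z0] `&` [set w | Z t w = z1]) =
    (pi x0 * w1 x0 x * w2 x x' * (pi y0 * (y0 == y)%:R * (y == y')%:R) *
     (pi z0 * w1 z0 z1))%:E.
  rewrite (total_probability_EFin _ _ (Z u) _ _ _ _ (PA x0 y0 z0 z1)).
  - by rewrite -mulr_sumr -mulr_sumr semigroup_row_sum// mulr1.
  - by do !apply: measurableI.
  - by [].
have {}PA x0 y0 z0 : Pr (A `&` [set w | X 0 w = x0] `&`
    [set w | Y 0 w = y0] `&` [set w | Z 0 w = z0]) =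
    (pi x0 * w1 x0 x * w2 x x' * (pi y0 * (y0 == y)%:R * (y == y')%:R) *
     pi z0)%:E.
  rewrite (total_probability_EFin _ _ (Z t) _ _ _ _ (PA x0 y0 z0)).
  - by rewrite -mulr_sumr -mulr_sumr semigroup_row_sum// mulr1.
  - by do !apply: measurableI.
  - by [].
have {}PA x0 y0 : Pr (A `&` [set w | X 0 w = x0] `&` [set w | Y 0 w = y0]) =
    (pi x0 * w1 x0 x * w2 x x' * (pi y0 * (y0 == y)%:R * (y == y')%:R))%:E.
  rewrite (total_probability_EFin _ _ (Z 0) _ _ _ _ (PA x0 y0)).
  - by rewrite -mulr_sumr pi1 mulr1.
  - by do !apply: measurableI.
  - by [].
have {}PA x0 : Pr (A `&` [set w | X 0 w = x0]) =
    (pi x0 * w1 x0 x * w2 x x' * (pi y * (y == y')%:R))%:E.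
  rewrite (total_probability_EFin _ _ (Y 0) _ _ _ _ (PA x0)).
  - rewrite -mulr_sumr -mulr_suml (bigD1 y)//= eqxx mulr1 big1 ?addr0// => z zy.
    by rewrite (negbTE zy) mulr0.
  - by do !apply: measurableI.
  - by [].
(* The sum over the starting point of [X] turns [pi x0 * w1 x0 x] into [pi x] by stationarity. *)
rewrite (total_probability_EFin _ _ (X 0) _ _ _ _ PA)//.
by rewrite -mulr_suml -mulr_suml semigroup_stationary.
Qed.

Lemma prob_one_time t x y : 0 <= t ->
  Pr ([set w | X t w = x] `&` [set w | Y t w = y]) = (pi x * pi y)%:E.
Proof.
move=> t0; have := prob_two_times t t x x y y t0 (lexx t).
rewrite subrr semigroup_id ?eqxx ?mulr1; [|by []|by right].
by move=> <-; rewrite setIid -setIA setIid.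
Qed.

Lemma prob_Y t y : 0 <= t -> Pr [set w | Y t w = y] = (pi y)%:E.
Proof.
move=> t0; rewrite (total_probability_EFin _ _ (X t) _ (fun x => pi x * pi y)).
- by rewrite -mulr_suml pi1 mul1r.
- exact: measurable_Y.
- exact: measurable_X.
- by move=> x; rewrite setIC prob_one_time.
Qed.

Lemma prob_Y_stays t u y : 0 <= t -> t <= u ->
  Pr ([set w | Y t w = y] `&` [set w | Y u w = y]) = (pi y)%:E.
Proof.
move=> t0 tu.
have mX := measurable_X; have mY := measurable_Y.
have PX x : Pr ([set w | Y t w = y] `&` [set w | Y u w = y] `&`
    [set w | X t w = x]) = (pi x * pi y)%:E.
  rewrite (total_probability_EFin _ _ (X u) _
    (fun x' => pi x * semigroup 1 P (u - t) x x' * pi y)).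
  - by rewrite -mulr_suml -mulr_sumr semigroup_row_sum// mulr1.
  - by do !apply: measurableI.
  - by [].
  - move=> x'; have := prob_two_times t u x x' y y t0 tu.
    rewrite eqxx mulr1 => <-; congr (Pr _).
    by apply/seteqP; split=> w; [move=> [[[]]]|move=> [[[]]]].
rewrite (total_probability_EFin _ _ (X t) _ _ _ _ PX)//.
- by rewrite -mulr_suml pi1 mul1r.
- by do !apply: measurableI.
Qed.

(** * Meetings of [X] and [Y] on a grid of mesh [h] *)

Section Grid.
Variables (h : R) (n : nat) (o : V).
Hypothesis h0 : 0 <= h.

Let time_ge0 k : 0 <= k%:R * h. Proof. exact: mulr_ge0. Qed.
Let time_le k : k%:R * h <= k.+1%:R * h.
Proof. by rewrite ler_wpM2r// ler_nat. Qed.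
Let time_step k : k.+1%:R * h - k%:R * h = h.
Proof. by rewrite -natr1 mulrDl mul1r addrC addKr. Qed.

(** [Y] has speed 0, so an entrance into [o] after time 0 has probability 0 and only the initial
    mass counts. *)
Lemma grid_hit_fixed :
  (Pr (\bigcup_(k in [set k | (k <= n)%N]) [set w | Y (k%:R * h) w = o])
   <= (pi o)%:E)%E.
Proof.
have mY := measurable_Y.
rewrite -[pi o]addr0 -[X in _ + X](mulr0 n%:R).
apply: (entrance_bound _ (fun k => [set w | Y (k%:R * h) w = o])) => //.
  by rewrite prob_Y.
move=> k _; rewrite (prob_setD _ _ _ (pi o) (pi o)) ?subrr//.
  by rewrite prob_Y.
by rewrite setIC prob_Y_stays.
Qed.

(* Counting the entrances into the diagonal rather than the visits keeps the
   bound finite as the mesh tends to 0. *)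
Lemma grid_meeting_at y :
  (Pr (\bigcup_(k in [set k | (k <= n)%N])
     ([set w | X (k%:R * h) w = y] `&` [set w | Y (k%:R * h) w = y]))
   <= (pi y ^+ 2 * (1 + n%:R * (expR (2 * h) - 1)))%:E)%E.
Proof.
have mX := measurable_X; have mY := measurable_Y.
rewrite mulrDr mulr1 mulrCA.
apply: (entrance_bound _ (fun k => _ `&` _)) => [k||k _].
- exact: measurableI.
- by rewrite prob_one_time.
(* Being at [(y, y)] at step [k.+1] has probability [pi y ^+ 2] by stationarity; being there at step
   [k] too costs the factor [semigroup 1 P h y y]. *)
rewrite (prob_setD _ _ _ (pi y ^+ 2) (pi y ^+ 2 * semigroup 1 P h y y)).
- rewrite lee_fin -[X in X - _]mulr1 -mulrBr ler_wpM2l ?sqr_ge0//.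
  exact: semigroup_diag_lower.
- exact: measurableI.
- exact: measurableI.
- by rewrite prob_one_time.
rewrite [X in Pr X = _](_ : _ = [set w | X (k%:R * h) w = y] `&`
    [set w | X (k.+1%:R * h) w = y] `&` [set w | Y (k%:R * h) w = y] `&`
    [set w | Y (k.+1%:R * h) w = y]).
  by rewrite prob_two_times// time_step eqxx mulr1 expr2 mulrAC.
by apply/seteqP; split=> w; [move=> [[? ?] [? ?]]|move=> [[[? ?] ?] ?]].
Qed.

(** The meetings are sorted by the position of [Y]. At [o], later the hub, the position of [X] is
    ignored: the horizon is chosen after the hub mass, so a bound growing with the horizon would not
    be small there. *)
Lemma grid_meeting :
  (Pr (\bigcup_(k in [set k | (k <= n)%N])
     [set w | X (k%:R * h) w = Y (k%:R * h) w])
   <= (pi o + \sum_(y | y != o) pi y ^+ 2 * (1 + n%:R * (expR (2 * h) - 1)))%:E)%E.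
Proof.
have mX := measurable_X; have mY := measurable_Y.
pose C y := if y == o
  then \bigcup_(k in [set k | (k <= n)%N]) [set w | Y (k%:R * h) w = o]
  else \bigcup_(k in [set k | (k <= n)%N])
     ([set w | X (k%:R * h) w = y] `&` [set w | Y (k%:R * h) w = y]).
have mC y : measurable (C y).
  rewrite /C; case: ifP => _; apply: bigcup_measurable => k _ //.
  exact: measurableI.
apply: (@le_trans _ _ (\sum_(y \in [set: V]) Pr (C y))%E).
  apply: content_sub_fsum => //.
  - exact: finite_finset.
  - by apply: bigcup_measurable => k _; exact: measurable_equal_values.
  - move=> w [k kn XY]; exists (Y (k%:R * h) w) => //.
    by rewrite /C; case: eqP => [Yo|_]; exists k.
rewrite fsbig_finType (bigD1 o)//= EFinD -sumEFin leeD//.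
  by rewrite /C eqxx; exact: grid_hit_fixed.
apply: lee_sum => y /negbTE yo; rewrite /C yo; exact: grid_meeting_at.
Qed.

End Grid.

(** Meeting before [L] is contained in the increasing union of the grid events of mesh [1 / 2 ^+ n].
    The grid bound is uniform in [n], so continuity from below applies. *)
Lemma meet_time_XY_lt (L : nat) (o : V) :
  (Pr [set w | (meet_time X Y w < L%:R%:E)%E] <=
   (pi o + (\sum_(y | y != o) pi y ^+ 2) * (1 + L%:R * (2 * expR 2)))%:E)%E.
Proof.
have mX := measurable_X; have mY := measurable_Y.
have [_ [cX [cY _]]] := chains.
pose G n := \bigcup_(k in [set k | (k <= L * 2 ^ n)%N])
  [set w | X (k%:R / 2 ^+ n) w = Y (k%:R / 2 ^+ n) w].
have mG n : measurable (G n).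
  by apply: bigcup_measurable => k _; exact: measurable_equal_values.
have mUG : measurable (\bigcup_n G n) by exact: bigcup_measurable.
have mM : measurable [set w | (meet_time X Y w < L%:R%:E)%E].
  rewrite -[X in measurable X]setTI; apply: emeasurable_fun_infty_o => //.
  exact: measurable_meet_time.
apply: (@le_trans _ _ (Pr (\bigcup_n G n))).
  apply: le_measure; rewrite ?inE//.
  move=> w /(meet_time_ltP _ _ _ _ _ cX cY)[n [k [kL XY]]].
  exists n => //; exists k => //=.
  by rewrite -(ler_nat R) natrM natrX ltW// -ltr_pdivrMr// exprn_gt0.
(* The grid point of index [k] reappears with index [2 k] when the mesh is halved. *)
have ndG : {homo G : n m / (n <= m)%N >-> (n <= m)%O}.
  apply/nondecreasing_seqP => n; apply/subsetPset => w [k /= kL XY].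
  exists k.*2 => /=; first by rewrite expnS mulnCA mul2n leq_double.
  suff -> : k.*2%:R / 2 ^+ n.+1 = k%:R / 2 ^+ n :> R by [].
  rewrite -muln2 natrM exprSr -mulf_div divff ?mulr1//.
have cG := nondecreasing_cvg_mu (mu := Pr) mG mUG ndG.
rewrite -(cvg_lim (@ereal_hausdorff R) cG).
apply: lime_le; first by apply/cvg_ex; exists (Pr (\bigcup_n G n)).
apply: nearW => n /=; have p0 : 0 < 2 ^+ n :> R by exact: exprn_gt0.
apply: le_trans (grid_meeting (2 ^+ n)^-1 (L * 2 ^ n)%N o _) _.
  by rewrite invr_ge0 ltW.
rewrite lee_fin -mulr_suml lerD2l ler_wpM2l ?sumr_ge0//.
  by move=> y _; exact: sqr_ge0.
rewrite lerD2l natrM natrX -mulrA ler_wpM2l//.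
(* Hence [2 ^+ n * (expR (2 / 2 ^+ n) - 1)] is at most [2 * expR (2 / 2 ^+ n)], and so at most
   [2 * expR 2] for every [n]. *)
have := expRB1_le R (2 / 2 ^+ n).
rewrite -(ler_pM2l p0) mulrA [X in _ <= X * _]mulrC divfK ?gt_eqF// => /le_trans.
apply; rewrite ler_wpM2l// ler_expR ler_pdivrMr// ler_peMr//.
by rewrite exprn_ege1// ler1n.
Qed.

(** Whatever the history up to an integer time, [X] and [Z] are both at [o] one unit later with
    conditional probability at least [c ^+ 2]. Time 0 contributes no factor, hence the exponent [n]
    for [n.+1] times. *)
Lemma no_simultaneous_visit (o : V) (c : R) n :
  0 <= c <= 1 -> (forall x, c <= semigroup 1 P 1 x o) ->
  (Pr [set w | forall i, (i <= n)%N -> ~ (X i%:R w = o /\ Z i%:R w = o)]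
   <= ((1 - c ^+ 2) ^+ n)%:E)%E.
Proof.
move=> /andP[c0 c1] Pc.
have mX := measurable_X; have mY := measurable_Y; have mZ := measurable_Z.
have [_ [_ [_ [_ fdd]]]] := chains.
pose H i := [set w | X i%:R w = o] `&` [set w | Z i%:R w = o].
have mH i : measurable (H i) by exact: measurableI.
pose F n := [set w | forall i, (i <= n)%N -> ~ H i w].
have mF n' : measurable (F n').
  by apply: bigcap_measurable => [|i _]; [exists 0%N|exact: measurableC].
have FE w n' : F n'.+1 w <-> (F n' `\` H n'.+1) w.
  split=> [Fw|[Fw Hw] i].
    by split=> [i ni|]; apply: Fw => //; exact: leqW.
  by rewrite leq_eqVlt => /orP[/eqP ->//|]; exact: Fw.
change (Pr (F n) <= ((1 - c ^+ 2) ^+ n)%:E)%E.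
elim: n => [|n IH]; first by rewrite expr0 probability_le1.
(* [f] is the history up to time [n]. It takes finitely many values, so conditioning becomes a
   finite sum over cylinders. *)
pose f w := [ffun i : 'I_n.+1 => (X i%:R w, Y i%:R w, Z i%:R w)].
pose cyl k (xs ys zs : nat -> V) := [set w | forall i, (i <= k)%N ->
  X i%:R w = xs i /\ Y i%:R w = ys i /\ Z i%:R w = zs i].
have mcyl k xs ys zs : measurable (cyl k xs ys zs).
  apply: bigcap_measurable => [|i _]; first by exists 0%N.
  change (measurable ([set w | X i%:R w = xs i] `&`
    ([set w | Y i%:R w = ys i] `&` [set w | Z i%:R w = zs i]))).
  by do !apply: measurableI.
(* Prolong the path of [w0] by a visit of X and Z to [o], with Y at rest. *)
have fcyl w0 : exists xs ys zs,
    [set w | f w = f w0] = cyl n xs ys zs /\ xs n.+1 = o /\ zs n.+1 = o /\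
    ys n.+1 = ys n.
  exists (fun i => if (i <= n)%N then X i%:R w0 else o),
    (fun i => Y (minn i n)%:R w0),
    (fun i => if (i <= n)%N then Z i%:R w0 else o).
  rewrite ltnn minnn (minn_idPr (leqnSn n)); split => //.
  apply/seteqP; split=> w /= => [fw i i_n|cw].
    have := congr1 (fun g : {ffun _} => g (Ordinal (i_n : (i < n.+1)%N))) fw.
    by rewrite !ffunE/= i_n (minn_idPl i_n) => -[-> -> ->].
  apply/ffunP => i; rewrite !ffunE; have i_n : (i <= n)%N by rewrite -ltnS.
  by have := cw i i_n; rewrite i_n (minn_idPl i_n) => -[-> [-> ->]].
have mf phi : measurable [set w | f w = phi].
  have [[w0 <-]|nphi] := pselect (exists w, f w = phi).
    by have [xs [ys [zs [-> _]]]] := fcyl w0.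
  rewrite (_ : [set w | _] = set0) // -subset0 => w /= fw.
  by apply: nphi; exists w.
have step phi : ((c ^+ 2)%:E * Pr (F n `&` [set w | f w = phi]) <=
    Pr (F n `&` H n.+1 `&` [set w | f w = phi]))%E.
  have [[w0 [Fw0 <-]]|nphi] := pselect (exists w, F n w /\ f w = phi); last first.
    rewrite (_ : F n `&` _ = set0) ?measure0 ?mule0//.
    by rewrite -subset0 => w /= Fw; apply: nphi; exists w.
  have [xs [ys [zs [E [xo [zo yn]]]]]] := fcyl w0.
  have cF : cyl n xs ys zs `<=` F n.
    move=> w cw i i_n [Xo Zo]; apply: (Fw0 i i_n).
    have : cyl n xs ys zs w0 by rewrite -E.
    by move=> /(_ i i_n)[xi [_ zi]]; move: (cw i i_n) => [xi' [_ zi']];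
      split; rewrite /= ?xi ?zi -?xi' -?zi'.
  rewrite E (setIidr cF).
  apply: (@le_trans _ _ (Pr (cyl n.+1 xs ys zs))); last first.
    apply: le_measure; rewrite ?inE//.
      by apply: measurableI => //; exact: measurableI.
    move=> w cw; have cnw : cyl n xs ys zs w.
      by move=> i i_n; apply: cw; exact: leqW.
    split=> //; split; first exact: cF.
    by have [] := cw n.+1 (leqnn _); rewrite xo zo => ? [_ ?].
  have tle k i : (i < k)%N -> i%:R <= i.+1%:R :> R by rewrite ler_nat.
  have PE k : Pr (cyl k xs ys zs) = (fdd_weight pi 1 P (fun i => i%:R) xs k *
      fdd_weight pi 0 P (fun i => i%:R) ys k *
      fdd_weight pi 1 P (fun i => i%:R) zs k)%:E.
    by apply: fdd => //; exact: tle.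
  (* One more unit of time multiplies the weight of the cylinder by [px] for [X], by 1 for the
     resting [Y] and by [pz] for [Z]. *)
  have := PE n; have := PE n.+1; rewrite /fdd_weight !big_ord_recr/= !mulrA.
  have -> : n.+1%:R - n%:R = 1 :> R by rewrite -natr1 addrC addKr.
  rewrite xo zo yn (semigroup_id _ _ 0) ?eqxx ?mulr1//; last by left.
  set wx := pi (xs 0) * _; set wy := \prod_(i < n) _; set wz := \prod_(i < n) _.
  set px := semigroup _ _ _ _ _; set pz := semigroup _ _ _ _ _ => -> Pn.
  have W0 : 0 <= wx * pi (ys 0) * wy * pi (zs 0) * wz.
    by rewrite -lee_fin -Pn.
  rewrite Pn -EFinM lee_fin.
  have cpx : c <= px by exact: Pc.
  have cpz : c <= pz by exact: Pc.
  have -> : wx * px * pi (ys 0) * wy * pi (zs 0) * wz * pz =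
    (px * pz) * (wx * pi (ys 0) * wy * pi (zs 0) * wz) by ring.
  by rewrite ler_wpM2r// expr2 ler_pM.
have Hn : ((c ^+ 2)%:E * Pr (F n) <= Pr (F n `&` H n.+1))%E.
  rewrite (total_probability _ _ f (F n))// ge0_sume_distrr//.
  rewrite (total_probability _ _ f (F n `&` H n.+1))//; last exact: measurableI.
  by apply: lee_sum => phi _; exact: step.
have [a PFE] : exists a, Pr (F n) = a%:E.
  by exists (fine (Pr (F n))); rewrite fineK// fin_num_measure.
have [b PHE] : exists b, Pr (F n `&` H n.+1) = b%:E.
  exists (fine (Pr (F n `&` H n.+1))); rewrite fineK// fin_num_measure//; exact: measurableI.
have -> : F n.+1 = F n `\` H n.+1 by apply/seteqP; split=> w /FE.
rewrite (prob_setD _ _ _ _ _ _ _ PFE PHE)// lee_fin.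
move: IH Hn; rewrite -/(F n) PFE PHE -EFinM !lee_fin => IH Hn.
apply: (@le_trans _ _ ((1 - c ^+ 2) * a)).
  by rewrite mulrBl mul1r lerD2l lerN2.
by rewrite [leRHS]exprS ler_wpM2l// subr_ge0 expr_le1.
Qed.

(** A joint visit of [X] and [Z] to [o] at an integer time up to [K] is a bad meeting, so a good
    meeting coming first must occur before [K.+1]. A union bound adds the event that no such visit
    takes place. *)
Lemma good_meeting_bound (o : V) (c : R) (K : nat) :
  0 <= c <= 1 -> (forall x, c <= semigroup 1 P 1 x o) ->
  (Pr [set w | (meet_time X Y w <=
                Order.min (meet_time X Z w) (meet_time Y Z w))%E] <=
   (pi o + (\sum_(y | y != o) pi y ^+ 2) * (1 + K.+1%:R * (2 * expR 2)) +
    (1 - c ^+ 2) ^+ K)%:E)%E.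
Proof.
move=> c01 Pc.
have mX := measurable_X; have mY := measurable_Y; have mZ := measurable_Z.
have [_ [cX [cY [cZ _]]]] := chains.
have mXY : measurable_fun [set: T] (meet_time X Y) by exact: measurable_meet_time.
have mXZ : measurable_fun [set: T] (meet_time X Z) by exact: measurable_meet_time.
have mYZ : measurable_fun [set: T] (meet_time Y Z) by exact: measurable_meet_time.
have mM : measurable [set w | (meet_time X Y w < K.+1%:R%:E)%E].
  by rewrite -[X in measurable X]setTI; exact: emeasurable_fun_infty_o.
have mF : measurable
    [set w | forall i, (i <= K)%N -> ~ (X i%:R w = o /\ Z i%:R w = o)].
  apply: bigcap_measurable => [|i _]; first by exists 0%N.
  apply: measurableC.
  change (measurable ([set w | X i%:R w = o] `&` [set w | Z i%:R w = o])).
  exact: measurableI.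
rewrite EFinD.
apply: le_trans (leeD (meet_time_XY_lt K.+1 o) (no_simultaneous_visit o c K c01 Pc)).
apply: le_trans (measureU2 _ mM mF).
apply: le_measure; rewrite ?inE.
- rewrite -[X in measurable X]setTI; apply: measurable_lee => //.
  exact: measurable_mine.
- exact: measurableU.
move=> w /= good.
have [|nF] := pselect (forall i, (i <= K)%N -> ~ (X i%:R w = o /\ Z i%:R w = o)).
  by right.
left; move/existsNP: nF => [i /not_implyP[iK /contrapT[Xo Zo]]] /=.
apply: (@le_lt_trans _ _ (i%:R : R)%:E); last by rewrite lte_fin ltr_nat.
apply: (le_trans good); rewrite ge_min; apply/orP; left.
by apply: ereal_inf_lbound; exists i%:R => //=; split; rewrite ?Xo ?Zo.
Qed.

End Chains.

(** * Choice of the parameters *)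

Lemma sum_sqr_le (R : realType) (V : finType) (p : V -> R) (Q : pred V) (b : R) :
  (forall x, 0 <= p x) -> \sum_x p x = 1 -> 0 <= b ->
  (forall x, Q x -> p x <= b) -> \sum_(x | Q x) p x ^+ 2 <= b.
Proof.
move=> p0 p1 b0 pb; apply: (@le_trans _ _ (\sum_(x | Q x) b * p x)).
  by apply: ler_sum => x Qx; rewrite expr2 ler_wpM2r// pb.
rewrite -mulr_sumr -[leRHS]mulr1 ler_wpM2l// -p1 [leRHS](bigID Q)/= lerDl.
exact: sumr_ge0.
Qed.

Lemma geometric_small (R : realType) (q e : R) : 0 <= q -> q < 1 -> 0 < e ->
  exists n, q ^+ n < e.
Proof.
move=> q0 q1 e0; have /cvg_expr : `|q| < 1 by rewrite ger0_norm.
by move=> /cvgr_lt /(_ e e0)[n _ /(_ n (leqnn n))]; exists n.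
Qed.

Theorem theorem1p3 (R : realType) (eps : R) (heps : 0 < eps) :
  exists (V : finType) (e : rel V),
    (1 < #|V|)%N /\ simple_graph e /\ graph_connected e /\
    forall (pi : V -> R), stationary_distribution (srw R e) pi ->
    forall (d : measure_display) (T : measurableType d) (Pr : probability T R)
           (X Y Z : R -> T -> V),
      indep_ctmc3 Pr (srw R e) pi 1 0 1 X Y Z ->
      (Pr [set w | (meet_time X Y w <=
                    Order.min (meet_time X Z w) (meet_time Y Z w))%E]
       < eps%:E)%E.

Proof.
have e3 : 0 < eps / 3 by rewrite divr_gt0.
(* The three thirds of [eps] go to [Y] starting at the hub, to [X] meeting [Y] elsewhere, and to [X]
   and [Z] missing each other at the hub. *)
pose m := Num.truncn (eps / 3)^-1.
have hub_small : (m.+1%:R + 1)^-1 < eps / 3.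
  rewrite -[ltRHS]invrK ltf_pV2 ?posrE ?invr_gt0// ?addr_gt0//.
  by apply: (lt_trans (truncnS_gt _)); rewrite ltrDl.
(* This is the value of [semigroup_column] at time 1 from a vertex other than the hub, the smallest
   over all starting points. It depends on [m] only, so [K] can be fixed before [N]. *)
pose c : R := (m.+1%:R + 1)^-1 * (1 - expR (- (1 + m.+1%:R^-1))).
have E1 : expR (- (1 + m.+1%:R^-1)) < 1 :> R.
  by rewrite expR_lt1 oppr_lt0 addr_gt0.
have M0 : 0 < (m.+1%:R + 1)^-1 :> R by rewrite invr_gt0 addr_gt0.
have M1 : (m.+1%:R + 1)^-1 <= 1 :> R by rewrite invf_le1 ?lerDr ?addr_gt0.
have c0 : 0 < c by rewrite mulr_gt0// subr_gt0.
have c1 : c <= 1 by exact: mulr_ile1.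
have [K qK] : exists K, (1 - c ^+ 2) ^+ K < eps / 3.
  apply: geometric_small => //; first by rewrite subr_ge0 expr_le1// ltW.
  by rewrite gtrBl exprn_gt0.
pose C : R := 1 + K.+1%:R * (2 * expR 2).
have C0 : 0 < C by rewrite addr_gt0// mulr_gt0// mulr_gt0// expR_gt0.
(* The number of cliques comes last: it has to beat the horizon factor [C], which depends on [K]. *)
pose N := Num.truncn (C / (eps / 3)).
have clique_small : N.+1%:R^-1 * C < eps / 3.
  by rewrite mulrC ltr_pdivrMr// -ltr_pdivrMl// mulrC truncnS_gt.
exists (option ('I_N.+1 * 'I_m.+1)), (windmill N m).
split; first by rewrite card_option card_prod !card_ord.
split; first exact: windmill_simple.
split; first exact: windmill_connected.
move=> pi st d T Pr X Y Z chains; have [pi0 [pi1 _]] := st.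
have sP := windmill_stochastic R N m.
apply: le_lt_trans (good_meeting_bound Pr _ _ X Y Z sP st chains None c K _ _) _.
- by rewrite c1 ltW.
- move=> x; rewrite (semigroup_column _ _ _ _ _ m.+1%:R)//; last exact: srw_to_hub.
  rewrite mulr1 /c; set a := _^-1; set E := expR _.
  rewrite mulrBr mulr1 mulrBl addrA lerD2r lerDl.
  by rewrite mulr_ge0// expR_ge0.
rewrite lte_fin (stationary_hub _ _ _ _ st) -/C.
(* A sum of squares of masses is at most the largest mass, here that of a clique vertex. *)
set S := \sum_(y | _) _; have SN : S <= N.+1%:R^-1.
  apply: sum_sqr_le => // -[u|//] _.
  exact: stationary_clique.
have SC : S * C < eps / 3.
  by apply: le_lt_trans clique_small; rewrite ler_wpM2r// ltW.
apply: lt_le_trans (ltrD (ltrD hub_small SC) qK) _.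
by rewrite le_eqVlt; apply/orP; left; apply/eqP; field.
Qed.
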